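(* Let $X$ be a locally compact Hadamard space, $\alpha>0$, and let $f:X\to\,]-\infty,+\infty]$ be an $\alpha$-weakly convex, pseudo-convex, proper and lower semicontinuous function with $\mathrm{Argmin} f\neq\varnothing$. Let $\{\lambda_k\}$ be a sequence with $0<\lambda_k<\frac1{2\alpha}$ for all $k$ and $\liminf_k\lambda_k>0$. Then, for any starting point in $X$, the sequence $\{x_k\}$ generated by the proximal point algorithm $x_{k+1}=J^f_{\lambda_k}x_k$ converges (in the metric) to an element of $\mathrm{Argmin} f$.
   Context: A Hadamard space is a complete CAT(0) space. $(1-t)x\oplus ty$ denotes the unique point $z$ of the geodesic segment $[x,y]$ with $d(x,z)=t\,d(x,y)$ and $d(y,z)=(1-t)d(x,y)$. For $f:X\to]-\infty,+\infty]$ with domain $D(f)=\{x\in X:f(x)<+\infty\}$: - $f$ is proper if $D(f)\neq\varnothing$, and lower semicontinuous if, at each point $x\in D(f)$, $\liminf_n f(y_n)\ge f(x)$ for each sequence $y_n\to x$. - $f$ is $\alpha$-weakly convex if $f(tx\oplus(1-t)y)\le tf(x)+(1-t)f(y)+\alpha t(1-t)d^2(x,y)$ for all $x,y\in X$, $t\in[0,1]$. - $f$ is pseudo-convex if $f(y)>f(x)$ implies that there exist $\beta(x,y)>0$ and $0<\delta(x,y)\le1$ such that $f(y)-f(tx\oplus(1-t)y)\ge t\beta(x,y)$ for all $t\in(0,\delta(x,y))$. For $0<\lambda<\frac1{2\alpha}$, the resolvent is $J^f_\lambda x:=\mathrm{Argmin}_{y\in X}\{f(y)+\frac1{2\lambda}d^2(y,x)\}$,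 whose existence and uniqueness for every $x\in X$ is taken as known. *)

(* Defs.v *)
From HB Require Import structures.
From mathcomp Require Import all_boot all_order all_algebra.
From mathcomp Require Import all_classical all_reals all_analysis.

Set Implicit Arguments.
Unset Strict Implicit.
Unset Printing Implicit Defensive.

Import Order.TTheory GRing.Theory Num.Theory.

Local Open Scope classical_set_scope.
Local Open Scope ring_scope.

#[short(type="completeMetricType")]
HB.structure Definition CompleteMetric (K : numDomainType) :=
  {M of Complete M & Metric K M}.

(* The norm of 'rV[R]_2 is the sup norm, so the Euclidean distance of the
   comparison plane has to be written out. *)
Definition eucl_dist (R : realType) (a b : 'rV[R]_2) : R :=
  Num.sqrt (\sum_i (a 0 i - b 0 i) ^+ 2).

Definition eucl_segment (R : realType) (a b : 'rV[R]_2) : set 'rV[R]_2 :=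
  [set (1 - t) *: a + t *: b | t in `[0, 1]].

Section CAT0.
Context {R : realType} {X : metricType R}.
Implicit Types (x y z : X) (c : R -> X) (t : R).

(* Values of c outside [0, d(x, y)] are irrelevant. *)
Definition geodesic x y c : Prop :=
  [/\ c 0 = x, c (mdist x y) = y &
      forall s t, s \in `[0, mdist x y] -> t \in `[0, mdist x y] ->
        mdist (c s) (c t) = `|s - t|].

Definition geodesic_segment x y : set X :=
  [set z | exists2 c, geodesic x y c & (c @` `[0, mdist x y]) z].

(* Sides of a triangle are indexed by 'I_3: side i goes from vertex i to
   vertex ordS i (addition modulo 3). *)
Definition geodesic_triangle (v : 'I_3 -> X) (c : 'I_3 -> R -> X) : Prop :=
  forall i, geodesic (v i) (v (ordS i)) (c i).

Definition comparison_triangle (v : 'I_3 -> X) (w : 'I_3 -> 'rV[R]_2) : Prop :=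
  forall i, eucl_dist (w i) (w (ordS i)) = mdist (v i) (v (ordS i)).

(* p' is the comparison point, on side i of the triangle w, of the point p
   of side i of the triangle v. *)
Definition comparison_point (v : 'I_3 -> X) (w : 'I_3 -> 'rV[R]_2) (i : 'I_3)
    (p : X) (p' : 'rV[R]_2) : Prop :=
  eucl_segment (w i) (w (ordS i)) p' /\ eucl_dist (w i) p' = mdist (v i) p.

(* (1 - t) x (+) t y; xget selects the point, which exists and is unique in a
   CAT(0) space for t in [0, 1]. *)
Definition geod_comb t x y : X :=
  xget x [set z | [/\ geodesic_segment x y z,
                      mdist x z = t * mdist x y &
                      mdist y z = (1 - t) * mdist x y]].

End CAT0.

Definition geodesic_space (R : realType) (X : metricType R) : Prop :=
  forall x y : X, exists c, geodesic x y c.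

Definition cat0 (R : realType) (X : metricType R) : Prop :=
  geodesic_space X /\
  forall (v : 'I_3 -> X) (c : 'I_3 -> R -> X) (w : 'I_3 -> 'rV[R]_2),
    geodesic_triangle v c -> comparison_triangle v w ->
    forall (i j : 'I_3) (p q : X) (p' q' : 'rV[R]_2),
      (c i @` `[0, mdist (v i) (v (ordS i))]) p ->
      (c j @` `[0, mdist (v j) (v (ordS j))]) q ->
      comparison_point v w i p p' -> comparison_point v w j q q' ->
      mdist p q <= eucl_dist p' q'.

Section Functions.
Context {R : realType} {X : metricType R}.
Implicit Types (f : X -> \bar R) (x y z : X).
Local Open Scope ereal_scope.

Definition effective_domain f : set X := [set x | f x < +oo].

Definition proper_fun f : Prop := effective_domain f !=set0.

(* The condition is imposed only at points of the domain; this is weaker than the library's lower_semicontinuous. *)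
Definition lsc_on_domain f : Prop :=
  forall x, effective_domain f x -> forall y : nat -> X,
    y @ \oo --> x -> f x <= limn_einf (f \o y).

(* t x (+) (1 - t) y is geod_comb (1 - t) x y. *)
Definition weakly_convex (alpha : R) f : Prop :=
  forall x y (t : R), (0 <= t <= 1)%R ->
    f (geod_comb (1 - t) x y) <=
      t%:E * f x + (1 - t)%:E * f y
        + (alpha * t * (1 - t) * mdist x y ^+ 2)%:E.

(* f(y) - f(z) >= t beta is written f(z) + t beta <= f(y), which is also
   meaningful (and true) when f(y) = +oo. *)
Definition pseudo_convex f : Prop :=
  forall x y, f x < f y ->
    exists beta delta : R, [/\ (0 < beta)%R, (0 < delta <= 1)%R &
      forall t : R, (0 < t < delta)%R ->
        f (geod_comb (1 - t) x y) + (t * beta)%:E <= f y].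

Definition argmin f : set X := [set x | forall y, f x <= f y].

Definition prox_objective f (lambda : R) x : X -> \bar R :=
  fun y => f y + (1 / (2 * lambda) * mdist y x ^+ 2)%:E.

Definition resolvent f (lambda : R) x : X :=
  xget x (argmin (prox_objective f lambda x)).

(* Not a consequence of weak convexity and lsc_on_domain: for f lsc only on
   its domain, the argmin may be empty. *)
Definition resolvent_well_defined (alpha : R) f : Prop :=
  forall (lambda : R) x, (0 < lambda < 1 / (2 * alpha))%R ->
    exists! z, argmin (prox_objective f lambda x) z.

End Functions.

(* Main.v *)
(* Pseudo-convexity together with the CN inequality makes every proximal step
   Fejer monotone: d(x_{k+1}, p)^2 + d(x_{k+1}, x_k)^2 <= d(x_k, p)^2 for each
   minimizer p, unless the step lands in Argmin f, where the sequence then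
   stays. Hence the steps tend to 0, and by Hopf--Rinow the sequence, being
   bounded, has a cluster point q. Comparing a short step near q with the
   proximal point of q for a smaller parameter shows that q is a fixed point of
   that resolvent; by pseudo-convexity q is a minimizer, and Fejer monotonicity
   with respect to q upgrades clustering to convergence. *)

Require Import Defs.
From HB Require Import structures.
From mathcomp Require Import all_boot all_order all_algebra.
From mathcomp Require Import all_classical all_reals all_analysis.
From mathcomp Require Import ring lra.

Set Implicit Arguments.
Unset Strict Implicit.
Unset Printing Implicit Defensive.

Import Order.TTheory GRing.Theory Num.Theory.
Import numFieldNormedType.Exports.

Local Open Scope classical_set_scope.
Local Open Scope ring_scope.

(** * Geodesic points, closed balls and ultrafilters near compact sets *)

Section Geodesics.
Context {R : realType} {X : metricType R}.
Implicit Types (p x y z : X) (r t : R).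

Lemma geod_combP x y t : geodesic_space X -> 0 <= t <= 1 ->
  [/\ geodesic_segment x y (geod_comb t x y),
      mdist x (geod_comb t x y) = t * mdist x y &
      mdist y (geod_comb t x y) = (1 - t) * mdist x y].
Proof.
move=> /(_ x y)[c [c0 c1 cd]] /andP[t0 t1].
have D0 := mdist_ge0 x y.
have tD : t * mdist x y \in `[0, mdist x y].
  by rewrite in_itv/= mulr_ge0//= ler_piMl.
have m0 : 0 \in `[0, mdist x y] by rewrite in_itv/= lexx.
have mD : mdist x y \in `[0, mdist x y] by rewrite in_itv/= lexx andbT.
rewrite /geod_comb; set P := [set z | _].
suff Pex : exists z, P z by exact: (xgetPex x Pex).
exists (c (t * mdist x y)); split.
- by exists c => //; exists (t * mdist x y).
- by rewrite -{1}c0 cd// sub0r normrN ger0_norm// mulr_ge0.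
- rewrite -{1}c1 cd// ger0_norm; last by rewrite subr_ge0 ler_piMl.
  by rewrite mulrBl mul1r.
Qed.

Definition cball p r : set X := [set y | mdist p y <= r].

Lemma closed_cball_mdist p r : closed (cball p r).
Proof.
move=> y cly; apply/ler_addgt0Pl => e e0.
have [z [pz]] := cly _ (nbhsx_ballx y e e0).
rewrite ballEmdist/= metric_sym => yz.
have := metric_triangle p z y; rewrite /cball/= in pz *; lra.
Qed.

(** The witness is the point at distance [r] from [p] on a geodesic to [z]. This is how geodesics
    enter the Hopf-Rinow argument. *)
Lemma cball_shrink p r e z : geodesic_space X -> 0 <= r -> 0 <= e ->
  cball p (r + e) z -> exists2 y, cball p r y & mdist y z <= e.
Proof.
rewrite /cball/= => gX r0 e0 pz.
have [le_r|gt_r] := leP (mdist p z) r; first by exists z => //; rewrite mdistxx.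
have D0 : 0 < mdist p z by lra.
have t01 : 0 <= r / mdist p z <= 1.
  by rewrite divr_ge0 ?(ltW D0)//= ler_pdivrMr// mul1r ltW.
have [_ d1 d2] := geod_combP p z gX t01.
exists (geod_comb (r / mdist p z) p z).
  by rewrite d1 divfK// gt_eqF.
by rewrite metric_sym d2 mulrBl mul1r divfK ?gt_eqF//; lra.
Qed.

(** The selection [pr] pushes [F] forward to a filter containing [K], and [y] is a cluster point of
    it. Were the complement of the ball in [F], some [z] outside would have [pr z] within [e] of [y]
    and of [z], against the triangle inequality. *)
Lemma ultra_near_compact (K : set X) (F : set_system X) e :
  compact K -> UltraFilter F -> 0 < e ->
  F [set z | exists2 y, K y & mdist y z <= e] ->
  exists2 y, K y & F (cball y (e + e)).
Proof.
move=> cK UF e0 FK.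
pose pr z := xget z [set y | K y /\ mdist y z <= e].
have prP z : (exists2 y, K y & mdist y z <= e) ->
    K (pr z) /\ mdist (pr z) z <= e.
  move=> [y Ky yz]; have Pex : exists y, K y /\ mdist y z <= e by exists y.
  exact: (xgetPex z Pex).
have GK : F (pr @^-1` K) by apply: filterS FK => z /prP[].
have [y [Ky cly]] := cK (pr @ F) _ GK.
exists y => //.
have [//|nF] := in_ultra_setVsetC (cball y (e + e)) UF.
pose B := [set pr z | z in ~` cball y (e + e) `&`
  [set z | exists2 y, K y & mdist y z <= e]].
have FB : F (pr @^-1` B).
  by apply: filterS (filterI nF FK) => z Hz; exists z.
have [_ [[z [nyz /prP[_ prz]] <-]]] := cly _ _ FB (nbhsx_ballx y e e0).
rewrite ballEmdist/= => ypr; case: nyz.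
have := metric_triangle y (pr z) z; rewrite /cball/=; lra.
Qed.

Lemma closed_ultra_compact (A : set X) : closed A ->
  (forall F : set_system X, UltraFilter F -> F A -> exists q : X, F --> q) ->
  compact A.
Proof.
move=> clA cvgA; rewrite compact_ultra => F UF FA.
have [q Fq] := cvgA F UF FA.
exists q; split=> //; apply: clA => B /Fq FB.
exact: filter_ex (filterI FA FB).
Qed.

End Geodesics.

(** * Compactness of closed balls *)

Section HopfRinow.
Context {R : realType} {X : completeMetricType R}.
Hypotheses (gX : geodesic_space X) (lcX : locally_compact [set: X]).
Implicit Types (p : X) (r s : R).

(** An ultrafilter on the ball is near the compact ball of radius [s - e / 4], hence contains a ball
    of radius [e]. It is therefore Cauchy, and completeness gives its limit. *)
Lemma compact_cball_lim p s : 0 <= s ->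
  (forall r, 0 <= r < s -> compact (cball p r)) -> compact (cball p s).
Proof.
move=> s0 cB; apply: closed_ultra_compact; first exact: closed_cball_mdist.
move=> F UF Fs.
suff cF : cauchy F by apply/cvg_ex; exact: cauchy_cvg.
apply: cauchy_exP => e e0.
have [lt_s|le_s] := ltP s e.
  exists p; apply: filterS Fs => z; rewrite ballEmdist /cball/=; lra.
have e40 : 0 < e / 4 by lra.
have [||y _ Fy] := ultra_near_compact (cB (s - e / 4) _) UF e40.
- lra.
- apply: filterS Fs => z pz; apply: cball_shrink => //; try lra.
  by rewrite subrK.
- exists y; apply: filterS Fy => z; rewrite ballEmdist /cball/=; lra.
Qed.

(** The radius is a parameter tending to [0] from the right, so that the near-covering form of
    compactness makes it uniform over [K]. *)
Lemma compact_cball_nbhs (K : set X) : compact K ->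
  exists2 d : R, 0 < d & forall x, K x -> compact (cball x d).
Proof.
move=> /compact_near_coveringP cK.
have [x Kx|d /= d0 dP] := cK R (0%R)^'+ (fun d x => compact (cball x d)) _.
  have [U] := lcX (I : [set: X] x); rewrite withinET => xU [cU clU].
  have [e /= e0 eU] : exists2 e : R, 0 < e & ball x e `<=` U.
    by apply/nbhs_ballP.
  have e20 : 0 < e / 2 by lra.
  exists (ball x (e / 2), [set d | d < e / 2]).
    by split; [exact: nbhsx_ballx|exact: nbhs_right_lt].
  move=> [y d]; rewrite /= ballEmdist/= => -[xy de].
  apply: (subclosed_compact _ cU); first exact: closed_cball_mdist.
  move=> z yz; apply: eU; rewrite ballEmdist/=.
  have := metric_triangle x y z; rewrite /cball/= in yz; lra.
exists (d / 2); first lra.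
by apply: dP; rewrite /=; [rewrite sub0r normrN gtr0_norm; lra|lra].
Qed.

(* Hopf--Rinow--Cohn-Vossen *)
Lemma compact_cball p r : compact (cball p r).
Proof.
have mono a b : a <= b -> compact (cball p b) -> compact (cball p a).
  move=> ab cb; apply: (subclosed_compact _ cb).
    exact: closed_cball_mdist.
  by move=> z /le_trans; apply.
have c0 : compact (cball p 0).
  by apply: compact_cball_lim => // t; lra.
(* Continuity argument on the radius: if [S] were bounded, its supremum would belong to it and could
   still be increased. *)
pose S := [set s | 0 <= s /\ compact (cball p s)].
have S0 : S 0 by split.
have [bS|nbS] := pselect (has_ubound S); last first.
  have [s Ss rs] : exists2 s, S s & r < s.
    apply: contrapT => H; apply: nbS; exists r => s Ss.
    by rewrite leNgt; apply/negP => rs; apply: H; exists s.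
  exact: mono (ltW rs) Ss.2.
have ss0 : 0 <= sup S by exact: ub_le_sup.
have cs : compact (cball p (sup S)).
  apply: compact_cball_lim => // t /andP[t0 ts].
  have [u [_ cu] tu] := sup_gt (ex_intro _ 0 S0) ts.
  exact: mono (ltW tu) cu.
have [d d0 dP] := compact_cball_nbhs cs.
have d20 : 0 < d / 2 by lra.
(* An ultrafilter on the larger ball is within [d / 2] of the compact one, so it contains some
   [cball y d] centred there, which is compact by the choice of [d]. *)
suff : S (sup S + d / 2) by move/(ub_le_sup bS); lra.
split; first lra.
apply: closed_ultra_compact; first exact: closed_cball_mdist.
move=> F UF Fs.
have [|y Ky Fy] := ultra_near_compact cs UF d20.
  by apply: filterS Fs => z; apply: cball_shrink => //; lra.
have := dP _ Ky; rewrite compact_ultra => /(_ F UF).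
by rewrite -splitr in Fy => /(_ Fy)[q [_ Fq]]; exists q.
Qed.

End HopfRinow.

(** * Comparison triangles and the CN inequality *)

Section Comparison.
Context {R : realType}.

Lemma eucl_distE (a b : 'rV[R]_2) :
  eucl_dist a b = Num.sqrt ((a 0 0 - b 0 0) ^+ 2 + (a 0 1 - b 0 1) ^+ 2).
Proof.
rewrite /eucl_dist big_ord_recl big_ord1.
congr (Num.sqrt (_ + (a 0 _ - b 0 _) ^+ 2)).
all: exact/val_inj.
Qed.

Lemma triangle_coords (a b c : R) : 0 <= a -> 0 <= c ->
  a <= b + c -> b <= a + c -> c <= a + b ->
  exists u v, u ^+ 2 + v ^+ 2 = c ^+ 2 /\ (u - a) ^+ 2 + v ^+ 2 = b ^+ 2.
Proof.
move=> a0 c0 abc bac cab.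
have [a_eq0|a_neq0] := eqVneq a 0.
  exists c, 0; have -> : b = c by lra.
  by rewrite a_eq0; split; ring.
(* Law of cosines; the triangle inequalities give [u ^+ 2 <= c ^+ 2]. *)
pose u := (a ^+ 2 + c ^+ 2 - b ^+ 2) / (2 * a).
have uE : u * a * 2 = a ^+ 2 + c ^+ 2 - b ^+ 2 by rewrite /u; field.
have apos : 0 < a by rewrite lt_neqAle eq_sym a_neq0.
have uc : u <= c by rewrite -(ler_pM2r apos); nra.
have cu : - c <= u by rewrite -(ler_pM2r apos); nra.
have u2 : 0 <= c ^+ 2 - u ^+ 2 by nra.
by exists u, (Num.sqrt (c ^+ 2 - u ^+ 2)); rewrite sqr_sqrtr//; split; lra.
Qed.

End Comparison.

(** The CN inequality for an arbitrary point of the segment: comparison is applied to [z] and the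
    opposite vertex [x], and in the plane the claim is an identity (Stewart). *)
Lemma cat0_sqr_mdist (R : realType) (X : metricType R) (a b x : X) (t : R) :
  cat0 X -> 0 <= t <= 1 ->
  mdist (geod_comb t a b) x ^+ 2 <= (1 - t) * mdist a x ^+ 2
    + t * mdist b x ^+ 2 - t * (1 - t) * mdist a b ^+ 2.
Proof.
move=> [gX cX] t01; have [[c0 c0P [s0 s0D s0z]] az _] := geod_combP a b gX t01.
set z := geod_comb t a b in s0z az *; have /andP[t0 t1] := t01.
have [u [v [uv uav]]] : exists u v, u ^+ 2 + v ^+ 2 = mdist a x ^+ 2 /\
    (u - mdist a b) ^+ 2 + v ^+ 2 = mdist b x ^+ 2.
  apply: triangle_coords; rewrite ?mdist_ge0//.
  - by rewrite (metric_sym b) addrC metric_triangle.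
  - by rewrite (metric_sym a b) metric_triangle.
  - by rewrite metric_triangle.
(* The default values of [nth] supply the third vertices, [x] and [(u, v)]. *)
pose V (i : 'I_3) := nth x [:: a; b] i.
pose W (i : 'I_3) : 'rV[R]_2 :=
  \row_j nth 0 (nth [:: u; v] [:: [:: 0; 0]; [:: mdist a b; 0]] i) j.
(* Side [0] has to be the geodesic [c0], on which [z] lies; the other two are arbitrary. *)
have cex (i : 'I_3) : exists ci, geodesic (V i) (V (ordS i)) ci /\
    (i = 0 -> (ci @` `[0, mdist (V i) (V (ordS i))]) z).
  have [->|i0] := eqVneq i 0; first by exists c0; split=> // _; exists s0.
  have [ci ciP] := gX (V i) (V (ordS i)).
  by exists ci; split=> // i0'; rewrite i0' eqxx in i0.
have [c cP] := choice cex.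
have sqrtE (e d : R) : 0 <= d -> e = d ^+ 2 -> Num.sqrt e = d.
  by move=> d0 ->; rewrite sqrtr_sqr ger0_norm.
have VW : comparison_triangle V W.
  case=> [[|[|[|//]]]] i; rewrite eucl_distE !mxE /V /=;
    apply: sqrtE; rewrite ?mdist_ge0//.
  - ring.
  - by rewrite -uav; ring.
  - by rewrite metric_sym -uv; ring.
have xW : comparison_point V W 2 x (W 2).
  split; last first.
    by rewrite eucl_distE; apply: sqrtE; rewrite ?mdist_ge0// mdistxx; ring.
  by exists 0; rewrite ?subr0 ?scale1r ?scale0r ?addr0//= in_itv/= lexx ler01.
have zW : comparison_point V W 0 z ((1 - t) *: W 0 + t *: W 1).
  split.
    by exists t; rewrite /= ?in_itv/= ?t0//; congr (_ + _ *: W _); exact/val_inj.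
  rewrite /V/= az eucl_distE !mxE /=; apply: sqrtE; last ring.
  by rewrite mulr_ge0// mdist_ge0.
have cx : (c 2 @` `[0, mdist (V 2) (V (ordS 2))]) x.
  have [[c20 _ _] _] := cP 2.
  by exists 0; rewrite ?c20//= in_itv/= lexx mdist_ge0.
have := cX V c W (fun i => (cP i).1) VW 0 2 z x _ _ ((cP 0).2 erefl) cx zW xW.
rewrite -(ler_pXn2r (n := 2))// ?nnegrE ?sqrtr_ge0 ?mdist_ge0//.
move=> /le_trans; apply; rewrite eucl_distE !mxE /=.
rewrite sqr_sqrtr ?addr_ge0 ?sqr_ge0// -uv -uav.
by rewrite le_eqVlt; apply/orP; left; apply/eqP; ring.
Qed.

(** * Two facts on real sequences *)

Lemma nonincreasing_ge0_step (R : realType) (u : nat -> R) (e : R) :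
  (forall n, 0 <= u n) -> (forall n, u n.+1 <= u n) -> 0 < e ->
  \forall n \near \oo, u n - u n.+1 < e.
Proof.
move=> u0 uS e0.
have /cvgrPdist_lt cu : cvgn u.
  apply: nonincreasing_is_cvgn; first exact/nonincreasing_seqP.
  by exists 0 => _ [n _ <-].
have e20 : 0 < e / 2 by lra.
have [N _ NP] := cu _ e20; exists N => // n /= Nn.
have := NP n Nn; have := NP n.+1 (leqW Nn).
by rewrite /= !ltr_distlC => /andP[? ?] /andP[? ?]; lra.
Qed.

(** The limit inferior is the supremum of the tail infima, so one of these is positive; it is finite
    because a term lies above it. *)
Lemma limn_einf_gt0 (R : realType) (u : nat -> R) :
  (0 < limn_einf (fun k => (u k)%:E))%E ->
  exists2 c : R, 0 < c & \forall n \near \oo, c <= u n.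
Proof.
rewrite limn_einf_lim (cvg_lim _ (@cvg_einfs_sup _ _))//.
move=> /ereal_sup_gt[_ [N _ <-] c0].
have cu n : (N <= n)%N -> (einfs (fun k => (u k)%:E) N <= (u n)%:E)%E.
  by move=> Nn; apply: ereal_inf_lbound; exists n.
move: c0 cu; case: (einfs _ N) => [c||] // c0 cu; last first.
  by have := cu N (leqnn N).
by exists c; [rewrite -lte_fin|exists N => // n /= /cu; rewrite lee_fin].
Qed.

(** * Proximal points *)

Section Prox.
Context {R : realType} {X : metricType R}.
Variable f : X -> \bar R.
Hypothesis f_gtNy : forall x, (-oo < f x)%E.
Implicit Types (p q x y z : X) (l : R).

Lemma resolventP alpha l x : resolvent_well_defined alpha f ->
  0 < l < 1 / (2 * alpha) -> argmin (prox_objective f l x) (resolvent f l x).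
Proof. by move=> rf /(rf _ x)[z [Pz _]]; apply: (xgetI x Pz). Qed.

Lemma fin_num_domain x : effective_domain f x -> f x \is a fin_num.
Proof. by move=> fx; rewrite fin_numElt f_gtNy. Qed.

Lemma argmin_prox_domain l x y : proper_fun f ->
  argmin (prox_objective f l x) y -> effective_domain f y.
Proof.
move=> [u fu] /(_ u); rewrite /prox_objective => H.
have {}H := le_lt_trans H (lte_add_pinfty fu (ltry _)).
by rewrite /effective_domain/=; case: (f y) H => [r||] //; rewrite ?ltry ?addye.
Qed.

Lemma argmin_prox_le l x y z : proper_fun f ->
  argmin (prox_objective f l x) y -> effective_domain f z ->
  fine (f y) + 1 / (2 * l) * mdist y x ^+ 2
    <= fine (f z) + 1 / (2 * l) * mdist z x ^+ 2.
Proof.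
move=> pf my dz; rewrite -lee_fin !EFinD.
by rewrite !fineK ?fin_num_domain//; [exact: my|exact: argmin_prox_domain my].
Qed.

Lemma argmin_prox_argmin l p y : 0 < l -> proper_fun f -> argmin f p ->
  argmin (prox_objective f l p) y -> y = p.
Proof.
move=> l0 pf mp my; have dy := argmin_prox_domain pf my.
have dp : effective_domain f p by exact: le_lt_trans (mp y) dy.
have := argmin_prox_le pf my dp; rewrite mdistxx expr0n/= mulr0 addr0.
have : fine (f p) <= fine (f y) by rewrite fine_le ?fin_num_domain.
have k0 : 0 < 1 / (2 * l) by rewrite divr_gt0 ?mulr_gt0.
have := mdist_ge0 y p => d0 fpy fyp; apply: mdist_positivity.
have : 1 / (2 * l) * mdist y p ^+ 2 <= 0 by lra.
rewrite pmulr_rle0// => H; apply/eqP; rewrite -sqrf_eq0 eq_le H sqr_ge0//.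
Qed.

(** If [f y < f q], moving from [q] towards [y] lowers [f] at least linearly, by [t * b], while the
    penalty grows only by [t ^+ 2 * m]. *)
Lemma fixed_argmin l q : geodesic_space X -> 0 < l -> proper_fun f ->
  pseudo_convex f -> argmin (prox_objective f l q) q -> argmin f q.
Proof.
move=> gX l0 pf pcf mq y; rewrite leNgt; apply/negP => /pcf.
move=> [b [d [b0 /andP[d0 d1] bP]]].
have dq := argmin_prox_domain pf mq.
have k0 : 0 < 1 / (2 * l) by rewrite divr_gt0 ?mulr_gt0.
pose m := 1 / (2 * l) * mdist y q ^+ 2.
have m0 : 0 <= m by rewrite mulr_ge0 ?sqr_ge0 ?ltW.
have e0 : 0 < b / (m + 1) by rewrite divr_gt0 ?ltr_wpDl.
(* The second bound yields [t * m < b], so that the linear gain wins. *)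
pose t := Num.min (d / 2) (b / (m + 1)).
have t0 : 0 < t by rewrite lt_min e0; lra.
have td : t < d by rewrite gt_min; apply/orP; left; lra.
have tb : t * (m + 1) <= b.
  by rewrite -ler_pdivlMr ?ltr_wpDl// ge_min lexx orbT.
have t01 : 0 <= 1 - t <= 1 by apply/andP; split; lra.
have /bP : 0 < t < d by rewrite t0.
have [_ _] := geod_combP y q gX t01.
set z := geod_comb _ _ _; move=> qz fz.
have dz : effective_domain f z.
  rewrite /effective_domain/=; apply: le_lt_trans dq; apply: le_trans fz.
  by rewrite leeDl// lee_fin mulr_ge0 ?ltW.
have {}fz : fine (f z) + t * b <= fine (f q).
  by rewrite -lee_fin EFinD !fineK ?fin_num_domain.
have := argmin_prox_le pf mq dz; rewrite mdistxx (metric_sym z) qz.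
have -> : 1 / (2 * l) * ((1 - (1 - t)) * mdist y q) ^+ 2 = t * (t * m).
  by rewrite /m; ring.
move=> H; have : t * b <= t * (t * m) by lra.
by rewrite ler_pM2l//; lra.
Qed.

(* Pseudo-convexity makes [f] decrease from [y] towards [p]; comparing [y] with
   the points of [p, y] close to it, the CN inequality gives the claim. *)
Lemma prox_fejer l p x y : cat0 X -> 0 < l -> pseudo_convex f ->
  argmin f p -> argmin (prox_objective f l x) y -> ~ argmin f y ->
  mdist y p ^+ 2 + mdist y x ^+ 2 <= mdist x p ^+ 2.
Proof.
move=> cX l0 pcf mp my nmy.
have fpy : (f p < f y)%E.
  rewrite ltNge; apply/negP => yp; apply: nmy => z; exact: le_trans yp (mp z).
have dp : effective_domain f p by exact: lt_le_trans fpy (leey _).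
have pf : proper_fun f by exists p.
have dy := argmin_prox_domain pf my.
have [b [d [b0 /andP[d0 d1] bP]]] := pcf _ _ fpy.
have k0 : 0 < 1 / (2 * l) by rewrite divr_gt0 ?mulr_gt0.
pose D := mdist p y ^+ 2; have D0 : 0 <= D := sqr_ge0 _.
apply/ler_addgt0Pr => e e0.
have e1 : 0 < e / (D + 1) by rewrite divr_gt0 ?ltr_wpDl.
(* Dividing the CN inequality by [t] will leave an error [t * D], which is at most [e] for this
   choice. *)
pose t := Num.min (d / 2) (e / (D + 1)).
have t0 : 0 < t by rewrite lt_min e1; lra.
have td : t < d by rewrite gt_min; apply/orP; left; lra.
have te : t * (D + 1) <= e.
  by rewrite -ler_pdivlMr ?ltr_wpDl// ge_min lexx orbT.
have t01 : 0 <= 1 - t <= 1 by apply/andP; split; lra.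
have /bP : 0 < t < d by rewrite t0.
have := cat0_sqr_mdist p y x cX t01.
set z := geod_comb _ _ _; move=> zx fz.
have dz : effective_domain f z.
  rewrite /effective_domain/=; apply: le_lt_trans dy; apply: le_trans fz.
  by rewrite leeDl// lee_fin mulr_ge0 ?ltW.
have {}fz : fine (f z) + t * b <= fine (f y).
  by rewrite -lee_fin EFinD !fineK ?fin_num_domain.
have := argmin_prox_le pf my dz => H.
have tb : 0 < t * b by rewrite mulr_gt0.
(* Since [f] is smaller at [z], minimality of [y] forces [z] to be no closer to [x]. *)
have {}H : mdist y x ^+ 2 <= mdist z x ^+ 2 by rewrite -(ler_pM2l k0); lra.
rewrite (metric_sym y p) (metric_sym x p) -/D in zx *.
have : t * (mdist y x ^+ 2 + (1 - t) * D) <= t * mdist p x ^+ 2 by lra.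
by rewrite ler_pM2l//; lra.
Qed.

(* Stability of proximal steps: [z] is a proximal point of [q] for the halved
   parameter, so if a step [x |-> y] with parameter at least [l] takes place
   near [q], testing each of [y] and [z] against the other cancels [f]. *)
Lemma prox_near_fixed l m q x y z e : 0 < l <= m -> proper_fun f ->
  argmin (prox_objective f m x) y -> argmin (prox_objective f (l / 2) q) z ->
  mdist q x <= e -> mdist q y <= e ->
  2 * mdist z q ^+ 2 <= (mdist z q + e) ^+ 2 + 2 * e ^+ 2.
Proof.
move=> /andP[l0 lm] pf my mz qx qy.
have dy := argmin_prox_domain pf my; have dz := argmin_prox_domain pf mz.
have := argmin_prox_le pf my dz; have := argmin_prox_le pf mz dy.
(* Halving [l] doubles the weight of [mdist z q ^+ 2], which thus beats the term in
   [mdist z x ^+ 2], of weight [k' <= k]. *)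
have -> : 1 / (2 * (l / 2)) = 2 * (1 / (2 * l)) by field; rewrite gt_eqF.
have k0 : 0 < 1 / (2 * l) by rewrite divr_gt0 ?mulr_gt0.
have kml : 1 / (2 * m) <= 1 / (2 * l).
  by rewrite !div1r lef_pV2 ?posrE ?mulr_gt0 ?ler_pM2l//; lra.
have km : 0 <= 1 / (2 * m) by rewrite divr_ge0//; lra.
move: kml km k0; set k := 1 / (2 * l); set k' := 1 / (2 * m) => kml km k0 H1 H2.
have zx : mdist z x ^+ 2 <= (mdist z q + e) ^+ 2.
  rewrite ler_sqr ?nnegrE ?mdist_ge0//; last first.
    by rewrite addr_ge0 ?mdist_ge0// (le_trans _ qx) ?mdist_ge0.
  by rewrite (le_trans (metric_triangle z q x))// lerD2l.
have yq : mdist y q ^+ 2 <= e ^+ 2.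
  by rewrite metric_sym ler_sqr ?nnegrE ?mdist_ge0// (le_trans _ qy) ?mdist_ge0.
have E0 : 0 <= k' * mdist y x ^+ 2 by rewrite mulr_ge0 ?sqr_ge0.
have E1 : k' * mdist z x ^+ 2 <= k * (mdist z q + e) ^+ 2.
  by rewrite ler_pM ?sqr_ge0.
have E2 : k * mdist y q ^+ 2 <= k * e ^+ 2 by rewrite ler_pM2l.
by rewrite -(ler_pM2l k0); lra.
Qed.

End Prox.

(** * Fejer monotone sequences *)

Section FejerMonotone.
Context {R : realType} {X : metricType R}.
Implicit Types (x : nat -> X) (p q : X).

(** Squared steps are bounded by the decrements of a nonincreasing nonnegative sequence. *)
Lemma fejer_step_cvg0 x p e :
  (forall k, mdist (x k.+1) p ^+ 2 + mdist (x k.+1) (x k) ^+ 2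
    <= mdist (x k) p ^+ 2) -> 0 < e ->
  \forall k \near \oo, mdist (x k.+1) (x k) < e.
Proof.
move=> fx e0; have e2 : 0 < e ^+ 2 by rewrite exprn_gt0.
have [|N _ NP] := @nonincreasing_ge0_step R (fun k => mdist (x k) p ^+ 2) _
    (fun k => sqr_ge0 _) _ e2.
  by move=> k; have := fx k; have := sqr_ge0 (mdist (x k.+1) (x k)); lra.
exists N => // k /= /NP; rewrite -ltr_sqr ?nnegrE ?mdist_ge0 ?ltW//.
by have := fx k; lra.
Qed.

(** Some term enters each ball around the cluster point, and monotonicity keeps all later ones
    inside. *)
Lemma fejer_cluster_cvg x q :
  (forall k, mdist (x k.+1) q <= mdist (x k) q) -> cluster (x @ \oo) q ->
  x @ \oo --> q.
Proof.
move=> fx clq; apply/metricType_numDomainType.cvgrPdist_lt => e e0.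
have [_ [[N _ <-]]] := clq (range x) (ball q e)
  (filterS (fun n _ => ex_intro2 _ _ n I erefl) filterT) (nbhsx_ballx q e e0).
rewrite ballEmdist/= => Ne; exists N => // n /= /subnK <-.
elim: (n - N)%N => [//|m]; apply: le_lt_trans.
by rewrite addSn !(metric_sym q) fx.
Qed.

Lemma cluster_seq_near x q e (P : nat -> Prop) :
  cluster (x @ \oo) q -> 0 < e -> (\forall k \near \oo, P k) ->
  exists2 k, P k & mdist q (x k) < e.
Proof.
move=> clq e0 nP.
have [_ [[k Pk <-]]] := clq [set x k | k in P] (ball q e)
  (filterS (fun n Pn => ex_intro2 _ _ n Pn erefl) nP) (nbhsx_ballx q e e0).
by rewrite ballEmdist/= => ke; exists k.
Qed.

End FejerMonotone.

Theorem theorem3p14 (R : realType) (X : completeMetricType R)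
    (cat0X : cat0 X) (lcX : locally_compact [set: X])
    (alpha : R) (alpha_gt0 : 0 < alpha)
    (f : X -> \bar R) (f_gtNy : forall x, (-oo < f x)%E)
    (f_wcvx : weakly_convex alpha f) (f_pcvx : pseudo_convex f)
    (f_proper : proper_fun f) (f_lsc : lsc_on_domain f)
    (resolvent_f : resolvent_well_defined alpha f)
    (argmin_f : argmin f !=set0)
    (lambda : nat -> R)
    (lambda_bnd : forall k, 0 < lambda k < 1 / (2 * alpha))
    (lambda_liminf : (0 < limn_einf (fun k => (lambda k)%:E))%E)
    (x0 : X) (x : nat -> X) (x_0 : x 0%N = x0)
    (x_S : forall k, x k.+1 = resolvent f (lambda k) (x k)) :
  exists2 p, argmin f p & x @ \oo --> p.
Proof.
have lambda_gt0 k : 0 < lambda k by have /andP[] := lambda_bnd k.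
have xP k : argmin (prox_objective f (lambda k) (x k)) (x k.+1).
  by rewrite x_S; exact: resolventP resolvent_f (lambda_bnd k).
have [[N xN]|x_nargmin] := pselect (exists k, argmin f (x k)).
  exists (x N) => //; apply: cvg_near_cst; exists N => // n /= /subnK <-.
  elim: (n - N)%N => [//|m IHm]; rewrite addSn.
  move: (xP (m + N)%N); rewrite IHm; exact: argmin_prox_argmin.
have fejer p k : argmin f p -> mdist (x k.+1) p ^+ 2
    + mdist (x k.+1) (x k) ^+ 2 <= mdist (x k) p ^+ 2.
  move=> mp; apply: prox_fejer (xP k) _ => // mx.
  by apply: x_nargmin; exists k.+1.
have fejer_le p k : argmin f p -> mdist (x k.+1) p <= mdist (x k) p.
  move=> /(fejer p k) H; rewrite -ler_sqr ?nnegrE ?mdist_ge0//.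
  by have := sqr_ge0 (mdist (x k.+1) (x k)); lra.
have [p mp] := argmin_f.
have [q [_ clq]] : cball p (mdist (x 0%N) p) `&` cluster (x @ \oo) !=set0.
  apply: (compact_cball cat0X.1 lcX); exists 0%N => // n _ /=.
  rewrite /cball/= metric_sym; elim: n => // n.
  by apply: le_trans; exact: fejer_le.
suff mq : argmin f q.
  by exists q => //; apply: fejer_cluster_cvg => // k; exact: fejer_le.
have [l l0 near_l] := limn_einf_gt0 lambda_liminf.
have l2_bnd : 0 < l / 2 < 1 / (2 * alpha).
  have [N _ /(_ N (leqnn N)) lN] := near_l.
  by have /andP[_] := lambda_bnd N; lra.
have zP := resolventP q resolvent_f l2_bnd.
set z := resolvent f (l / 2) q in zP.
suff zq : z = q.
  by rewrite zq in zP; apply: fixed_argmin zP => //; [exact: cat0X.1|lra].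
apply: mdist_positivity; apply/eqP; rewrite eq_le mdist_ge0 andbT.
rewrite leNgt; apply/negP => D0.
(* With [D] for [mdist z q], an iterate and a step both below [D / 8] put two consecutive iterates
   within [D / 4] of [q]; [prox_near_fixed] then gives [2 * D ^+ 2 <= 27 / 16 * D ^+ 2], which is
   absurd. *)
have e0 : 0 < mdist z q / 8 by lra.
have near_step := fejer_step_cvg0 (fun k => fejer p k mp) e0.
have [k [lk stepk] qk] := cluster_seq_near clq e0 (filterI near_l near_step).
have l_lk : 0 < l <= lambda k by rewrite l0.
have qSk : mdist q (x k.+1) <= mdist z q / 4.
  by have := metric_triangle q (x k) (x k.+1); rewrite (metric_sym (x k)); lra.
have qk4 : mdist q (x k) <= mdist z q / 4 by lra.
have := prox_near_fixed f_gtNy l_lk f_proper (xP k) zP qk4 qSk.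
by have := exprn_gt0 2 D0; nra.
Qed.
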